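(* Let $p>3$ be a prime and let $G$ be a non-abelian group of order $p^5$ of nilpotency class at least $3$ such that $\mathrm{cd}(G) = \{ 1, p \}$. (1) If $Z(G)$ is non-cyclic, then $\mathrm{cod}(G) = \{ 1, p, p^2, p^3 \}$. (2) If $Z(G)$ is cyclic and (a) the nilpotency class of $G$ is $3$, then $|\mathrm{cod}(G)|=4$ and $1, p, p^4 \in \mathrm{cod}(G)$; further, if $G/G'$ is not elementary abelian, then $\mathrm{cod}(G) = \{ 1, p, p^2, p^4 \}$; (b) the nilpotency class of $G$ is $4$, then $\mathrm{cod}(G) = \{ 1, p, p^2, p^3, p^4 \}$.
   Context: For an irreducible complex character $\chi$ of a finite group $G$, its codegree is $\mathrm{cod}(\chi) = |G:\ker\chi|/\chi(1)$, and $\mathrm{cod}(G) = \{\mathrm{cod}(\chi) : \chi \in \mathrm{Irr}(G)\}$. $\mathrm{cd}(G) = \{\chi(1) : \chi\in\mathrm{Irr}(G)\}$ is the set of irreducible complex character degrees, and $G'$ is the commutator subgroup. *)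

(* Defs.v *)
From mathcomp Require Import all_boot all_order all_fingroup all_algebra.
From mathcomp Require Import all_solvable all_field all_character.
From mathcomp Require Import finmap.

Set Implicit Arguments.
Unset Strict Implicit.
Unset Printing Implicit Defensive.

Import GroupScope GRing.Theory Num.Theory.

(* Degrees and codegrees are kept in algC, where the quotient defining a      *)
(* codegree is exact.                                                         *)
Definition codegree (gT : finGroupType) (G : {group gT}) (chi : 'CF(G)) :
    algC :=
  (#|G : cfker chi|%:R / chi 1%g)%R.

Definition cd (gT : finGroupType) (G : {group gT}) : {fset algC} :=
  [fset ('chi[G]_i 1%g)%R | i : Iirr G]%fset.

Definition cod (gT : finGroupType) (G : {group gT}) : {fset algC} :=
  [fset codegree ('chi[G]_i)%R | i : Iirr G]%fset.

(* Main.v *)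
Require Import Defs.
From mathcomp Require Import all_boot all_order all_fingroup all_algebra.
From mathcomp Require Import all_solvable all_field all_character.
From mathcomp Require Import finmap zify.

Import GroupScope GRing.Theory Num.Theory.

(* A linear character contains G' in its kernel, so its codegree is at most    *)
(* |G : G'|/p <= p^2; a nonlinear one has codegree |G : ker|/p. A quotient of  *)
(* a p-group in which the n-th lower central term (n > 1) survives has order   *)
(* at least p^(n+1), so separating consecutive lower central terms by an       *)
(* irreducible character realises the required codegrees, while p^4 occurs     *)
(* exactly when the centre is cyclic. The delicate point is that in class 3    *)
(* with cyclic centre p^3 never occurs, whether or not G / G' is elementary    *)
(* abelian.                                                                    *)

(** Let n be the base-p logarithm of |G : ker chi|. By [codegree_p5] a linear chi has n <= 2 and
    codegree p^n, and a nonlinear one has 3 <= n <= 5 and codegree p^(n-1), so everything turns on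
    which of 3, 4, 5 occur. The value 5 means that chi is faithful, which for a p-group is possible
    exactly when the centre is cyclic. Existence is mostly [cod_lcn_sep]. In class 3 with cyclic
    centre, n = 4 would mean a kernel of order p; [class3_card_cfker_neq] refutes this by making G'
    central. *)

Lemma logn_indexg (p : nat) (gT : finGroupType) (G H : {group gT}) :
  H \subset G -> (logn p #|H| + logn p #|G : H|)%N = logn p #|G|.
Proof. by move=> sHG; rewrite -lognM ?cardG_gt0 // Lagrange. Qed.

Lemma expg_indexg (gT : finGroupType) (G N : {group gT}) (x : gT) :
  N <| G -> x \in G -> x ^+ #|G : N| \in N.
Proof.
move=> nsNG Gx; have nNx := subsetP (normal_norm nsNG) x Gx.
rewrite coset_idr ?groupX // morphX //= -card_quotient ?normal_norm //.
by rewrite expg_cardG ?mem_quotient.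
Qed.

Lemma expg_card_p2_noncyclic (p : nat) (gT : finGroupType) (Q : {group gT})
    (x : gT) :
  prime p -> #|Q| = (p ^ 2)%N -> ~~ cyclic Q -> x \in Q -> x ^+ p = 1.
Proof.
move=> p_pr oQ ncQ Qx; apply/eqP; rewrite -order_dvdn.
have: #[x] %| p ^ 2 by rewrite -oQ order_dvdG.
case/dvdn_pfactor=> // -[|[|[|//]]] _ ox; rewrite ox ?dvd1n //.
case/negP: ncQ; apply/cyclicP; exists x; apply/eqP.
by rewrite eq_sym eqEcard cycle_subG Qx oQ -ox -orderE leqnn.
Qed.

(** * Lower central series of p-groups *)

Lemma lcn_proper (gT : finGroupType) (G : {group gT}) (n : nat) :
  nilpotent G -> (0 < n)%N -> 'L_n(G) != 1 -> 'L_n.+1(G) \proper 'L_n(G).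
Proof.
case: n => // n nilG _ Ln; rewrite properE lcn_subS /=.
apply: contra Ln; rewrite lcnSn => sL.
by move/forall_inP: nilG => /(_ 'L_n.+1(G)%G); apply; rewrite subsetI lcn_sub.
Qed.

(** The series descends strictly until it reaches 1 just after the class, and each strict step in a
    p-group costs a factor of at least p. *)
Lemma nil_class_lcn_logn (p : nat) (gT : finGroupType) (G : {group gT})
    (n : nat) :
  p.-group G -> (0 < n)%N -> (nil_class G < n + logn p #|'L_n(G)|)%N.
Proof.
move=> pG; have nilG := pgroup_nil pG.
have [m] := ubnP ((nil_class G).+1 - n)%N.
elim: m n => // m IHm n ltm n_gt0.
have [ltcn | lenc] := ltnP (nil_class G) n; first exact: ltn_addr.
have Ln : 'L_n(G) != 1.
  case: n n_gt0 lenc {ltm} => // n _; rewrite ltnNge; apply: contra => /eqP Ln.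
  exact/(lcn_nil_classP _ nilG).
have /properG_ltn_log := lcn_proper _ _ _ nilG n_gt0 Ln.
have pLn : p.-group 'L_n(G) := pgroupS (lcn_sub n G) pG.
move/(_ p pLn) => ltL; have := IHm n.+1; rewrite ltnS => /(_ _ isT) IH.
apply: leq_trans (IH _) _; last by rewrite addSnnS leq_add2l.
by rewrite subSS (leq_trans _ (ltm : _ <= m)%N) // subSn.
Qed.

(** The quotient G / N has class at least n, while a group of order p^m has class at most max(1, m -
    1). *)
Lemma lcn_logn_indexg (p : nat) (gT : finGroupType) (G N : {group gT})
    (n : nat) :
    p.-group G -> N <| G -> (1 < n)%N -> ~~ ('L_n(G) \subset N) ->
  (n < logn p #|G : N|)%N.
Proof.
move=> pG nsNG n_gt1 notLN; have nNG := normal_norm nsNG.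
have pQ : p.-group (G / N) := quotient_pgroup N pG.
have clQ : (n <= nil_class (G / N))%N.
  case: n n_gt1 notLN => // n _; rewrite ltnNge; apply: contra.
  move/(lcn_nil_classP _ (pgroup_nil pQ)) => LQ.
  rewrite -quotient_sub1 ?(subset_trans (lcn_sub _ _)) //.
  by rewrite /quotient morphim_lcn // -/(quotient _ _) LQ.
have := leq_trans clQ (nil_class_pgroup pQ).
rewrite card_quotient // leq_max leqNgt n_gt1 /=.
by case: (logn _ _) => [|m] //=; rewrite leqNgt ltnW.
Qed.

(** * From lower central terms to kernels of irreducible characters *)

(** A normal subgroup is the intersection of the kernels of the irreducible characters whose kernel
    contains it. *)
Lemma exists_irr_sep (gT : finGroupType) (G N : {group gT}) (A : {set gT}) :
    N <| G -> ~~ (A \subset N) ->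
  exists2 i : Iirr G, N \subset cfker ('chi_i)%R
    & ~~ (A \subset cfker ('chi_i)%R).
Proof.
move=> nsNG; rewrite -{1}(cap_cfker_normal nsNG).
case: (pickP (fun i : Iirr G =>
    (N \subset cfker ('chi_i)%R) && ~~ (A \subset cfker ('chi_i)%R)))
  => [i | sep].
  by case/andP=> sNi sAi _; exists i.
case/bigcapsP=> i sNi; have := sep i.
by rewrite sNi /= => /negbFE.
Qed.

(** The kernel contains G' and has cyclic quotient, since the centre of a linear character is all of
    G. Equality with G' would make G / G' cyclic, hence the nilpotent group G abelian. *)
Lemma lin_char_logn_index (p : nat) (gT : finGroupType) (G : {group gT})
    (i : Iirr G) :
    p.-group G -> ~~ abelian G -> ('chi_i)%R \is a linear_char ->
  (logn p #|G : cfker ('chi_i)%R| < logn p #|G : G^`(1)|)%N.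
Proof.
move=> pG nabG lin_i; have sG'i : G^`(1) \subset cfker ('chi_i)%R.
  by rewrite -lin_irr_der1.
have sG'G := der_sub 1 G; have sKG := cfker_sub ('chi_i)%R.
have pK := pgroupS sKG pG.
rewrite -(ltn_add2l (logn p #|cfker ('chi_i)%R|)) logn_indexg //.
rewrite -(logn_indexg p _ _ _ sG'G) ltn_add2r.
apply: properG_ltn_log => //; rewrite properEneq sG'i andbT.
apply: contra nabG => /eqP G'i; apply: cyclic_abelian.
apply: cyclic_nilpotent_quo_der1_cyclic (pgroup_nil pG) _.
have ZG : 'Z(('chi_i)%R)%CF = G :> {set gT}.
  apply/eqP; rewrite eqEsubset cfcenter_sub; apply/subsetP=> x Gx.
  by rewrite irr_cfcenterE // normC_lin_char // lin_char1.
by have := cfcenter_cyclic ('chi_i)%R; rewrite ZG G'i.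
Qed.

Lemma cyclic_logn_le1 (p : nat) (gT : finGroupType) (G : {group gT}) :
  p.-group G -> (logn p #|G| <= 1)%N -> cyclic G.
Proof.
move=> pG le1; have [-> | ntG] := eqVneq (G : {set gT}) 1; first exact: cyclic1.
have [p_pr _ [m oG]] := pgroup_pdiv pG ntG.
move: le1; rewrite oG pfactorK // ltnS leqn0 => /eqP m0.
by apply: prime_cyclic; rewrite oG m0 expn1.
Qed.

Lemma logn_indexg_der1 (p : nat) (gT : finGroupType) (G : {group gT}) :
  p.-group G -> ~~ abelian G -> (1 < logn p #|G : G^`(1)|)%N.
Proof.
move=> pG; rewrite ltnNge; apply: contra => le1; apply: cyclic_abelian.
apply: cyclic_nilpotent_quo_der1_cyclic (pgroup_nil pG) _.
apply: cyclic_logn_le1 (quotient_pgroup _ pG) _.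
by rewrite card_quotient ?der_norm.
Qed.

(* Otherwise 'L_2 / 'L_3 has order p, so [c, g]^p = [c^p, g] = 1 for c in 'L_2, *)
(* and the cyclic group 'L_3 has exponent p.                                   *)
Lemma class3_card_lcn3 (p : nat) (gT : finGroupType) (G : {group gT}) :
    prime p -> #|G| = (p ^ 5)%N -> nil_class G = 3 -> cyclic 'Z(G) ->
  #|'L_3(G)| = p.
Proof.
move=> p_pr oG clG cycZ.
have pG : p.-group G by rewrite /pgroup oG pnatX pnat_id.
have lt n := nil_class_lcn_logn p _ G n pG; rewrite clG in lt.
have L3Z : 'L_3(G) \subset 'Z(G) by rewrite -nil_class3 clG.
have pL3 : p.-group 'L_3(G) := pgroupS (lcn_sub 3 G) pG.
have log3 : (0 < logn p #|'L_3(G)|)%N by have := lt 3 isT; lia.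
suffices le1 : (logn p #|'L_3(G)| <= 1)%N.
  by rewrite (card_pgroup pL3); have -> : logn p #|'L_3(G)| = 1%N by lia.
have nabG : ~~ abelian G by rewrite -nil_class1 clG.
have log23 : (logn p #|'L_3(G)| + logn p #|'L_2(G) : 'L_3(G)| =
    logn p #|'L_2(G)|)%N by rewrite logn_indexg ?lcn_subS.
have log2 : (logn p #|'L_2(G)| + logn p #|G : 'L_2(G)| = 5)%N.
  by rewrite logn_indexg ?lcn_sub // oG pfactorK.
have logG' : (1 < logn p #|G : 'L_2(G)|)%N by rewrite lcn2 logn_indexg_der1.
have [//|log3gt] := leqP (logn p #|'L_3(G)|) 1.
(* Order count: |G : G'| and, by the assumption being refuted, |'L_3| are both at least p^2, which
   leaves at most one factor p. *)
have idx : (#|'L_2(G) : 'L_3(G)| %| p)%N.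
  have /dvdn_pfactor[|m _ om] // : (#|'L_2(G) : 'L_3(G)| %| p ^ 5)%N.
    by rewrite -oG (dvdn_trans (dvdn_indexg _ _)) ?cardSg ?lcn_sub.
  by rewrite om pfactorK // in log23; rewrite om (@dvdn_exp2l p m 1) //; lia.
suffices expL3 : exponent 'L_3(G) %| p.
  rewrite (exponent_cyclic (cyclicS L3Z cycZ)) in expL3.
  have := dvdn_leq_log p (prime_gt0 p_pr) expL3.
  by rewrite (logn_prime p p_pr) eqxx leqNgt log3gt.
have abL3 : abelian 'L_3(G) := abelianS L3Z (center_abelian G).
have genL3 : 'L_3(G) = <<commg_set 'L_2(G) G>> by rewrite lcnSn.
rewrite genL3 abelian_exponent_gen; last first.
  by rewrite -abelian_gen -genL3.
apply/exponentP => _ /imset2P[c g L2c Gg ->].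
have Zc : c ^+ p \in 'Z(G).
  apply: (subsetP L3Z); case/dvdnP: idx => q ->; rewrite mulnC expgM groupX //.
  exact: expg_indexg (lcn_normalS 2 G) L2c.
have Zcg : [~ c, g] \in 'Z(G).
  by apply: (subsetP L3Z); rewrite genL3 mem_gen // imset2_f.
rewrite -commXg; first by apply/eqP/commgP; exact: commute_sym (centerC Gg Zc).
have Gc : c \in G := subsetP (lcn_sub 2 G) c L2c.
exact: (centerC Gc Zcg).
Qed.

(* Writing K for the kernel, K = 'L_3(G) and G / K has cyclic centre           *)
(* D / K = <uK> of order p^2 containing G' / K. Commutators have order         *)
(* dividing p modulo K, so they lie in <u^p>K, which is central in G.          *)
Lemma class3_card_cfker_neq (p : nat) (gT : finGroupType) (G : {group gT})
    (i : Iirr G) :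
    prime p -> #|G| = (p ^ 5)%N -> nil_class G = 3 -> cyclic 'Z(G) ->
  ('chi_i)%R 1 = p%:R%R -> #|cfker ('chi_i)%R| != p.
Proof.
move=> p_pr oG clG cycZ chi1; apply/eqP=> oK.
have pG : p.-group G by rewrite /pgroup oG pnatX pnat_id.
have nilG := pgroup_nil pG.
set K := cfker_group ('chi_i)%R; set D := 'Z(('chi_i)%R)%CF.
have nsKG : K <| G := cfker_normal _.
have nKG := normal_norm nsKG.
have oL3 := class3_card_lcn3 p _ _ p_pr oG clG cycZ.
have L3Z : 'L_3(G) \subset 'Z(G) by rewrite -nil_class3 clG.
have KZ : K \subset 'Z(G).
  apply: prime_meetG; first by rewrite /= oK.
  by rewrite meet_center_nil // -cardG_gt1 /= oK prime_gt1.
(* A cyclic group has only one subgroup of each order. *)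
have defK : K :=: 'L_3(G).
  by apply/eqP; rewrite (eq_subG_cyclic cycZ) //= oK oL3.
have nsDG : D <| G := cfcenter_normal _.
have nsKD : K <| D := cfker_center_normal _.
have defZ : D / K = 'Z(G / K) := cfcenter_eq_center i.
have nDG := normal_norm nsDG.
have sDG := normal_sub nsDG.
have sG'D : G^`(1) \subset D.
  rewrite -(quotientSGK _ (normal_sub nsKD)); last first.
    exact: subset_trans (der_sub 1 G) nKG.
  by have := lcn_central 2 G; rewrite -defK lcn2 defZ.
have abGD : abelian (G / D) by rewrite sub_der1_abelian.
(* Since G / D is abelian, chi(1)^2 = |G : D|. *)
have oGD : #|G : D| = (p ^ 2)%N.
  apply/eqP; rewrite -eqC_nat -(irr1_abelian_bound abGD).
  by rewrite chi1 -natrX.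
(* Otherwise G / K is cyclic modulo its centre, hence abelian, and G' <= K <= Z(G) contradicts class
   3. *)
have ncGD : ~~ cyclic (G / D).
  apply/negP=> cycGD.
  have abGK : abelian (G / K).
    apply: cyclic_center_factor_abelian; rewrite -defZ.
    by rewrite (isog_cyclic (third_isog (normal_sub nsKD) nsKG nsDG)).
  by have := subset_trans (der1_min nKG abGK) KZ; rewrite -nil_class2 clG.
have expD x : x \in G -> x ^+ p \in D.
  move=> Gx; have nDx := subsetP nDG x Gx.
  rewrite coset_idr ?groupX // morphX //=.
  apply: (expg_card_p2_noncyclic p _ (G / D)%G) => //=.
    by rewrite card_quotient.
  exact: mem_quotient.
have oDK : #|D / K| = (p ^ 2)%N.
  have : (#|K| * #|D : K| * #|G : D| = p ^ 5)%N.
    by rewrite (Lagrange (normal_sub nsKD)) Lagrange.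
  rewrite oGD -card_quotient ?normal_norm //= oK => /eqP.
  rewrite (expnD p 3 2) eqn_pmul2r ?expn_gt0 ?prime_gt0 //.
  by rewrite (expnS p 2) eqn_pmul2l ?prime_gt0 // => /eqP.
have [ubar defU] := cyclicP (cfcenter_cyclic ('chi_i)%R).
have /morphimP[u nKu Du uE] : ubar \in D / K by rewrite defU cycle_id.
(* As u is central modulo K, [u, g] lies in the central subgroup K of order p, so [u^p, g] =
   [u, g]^p = 1. *)
have cenU g : g \in G -> [~ u ^+ p, g] = 1.
  move=> Gg; have Gu : u \in G := subsetP sDG u Du.
  have Kug : [~ u, g] \in K.
    have nKg := subsetP nKG g Gg.
    rewrite coset_idr ?groupR // morphR //=; apply/eqP/commgP.
    apply/commute_sym/(@centerC _ (G / K)); first exact: mem_quotient.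
    by rewrite -defZ mem_quotient.
  rewrite commXg; first by rewrite -oK; exact: (@expg_cardG _ K).
  have Zug : [~ u, g] \in 'Z(G) := subsetP KZ _ Kug.
  exact: (centerC Gu Zug).
suffices sG'Z : G^`(1) \subset 'Z(G) by move: sG'Z; rewrite -nil_class2 clG.
rewrite gen_subG; apply/subsetP=> _ /imset2P[x y Gx Gy ->].
have Gxy := groupR Gx Gy; have nKx := subsetP nKG x Gx.
have nKy := subsetP nKG y Gy.
have Dxy : [~ x, y] \in D by apply: (subsetP sG'D); rewrite mem_commg.
(* Modulo K, [x, y] is central, so [x, y]^p = [x^p, y]; this is trivial because x^p lies in D. *)
have xyp : coset K [~ x, y] ^+ p = 1.
  have Zxy : coset K [~ x, y] \in 'Z(G / K) by rewrite -defZ mem_quotient.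
  rewrite morphR //= in Zxy *; rewrite -commXg; last first.
    by apply: centerC Zxy; apply: mem_quotient.
  apply/eqP/commgP/commute_sym/(@centerC _ (G / K)); first exact: mem_quotient.
  by rewrite -morphX //= -defZ mem_quotient ?expD.
have /cycleP[k xyE] : coset K [~ x, y] \in <[ubar]>.
  by rewrite -defU mem_quotient.
have ord_u : #[ubar] = (p ^ 2)%N by rewrite orderE -defU.
have /dvdnP[j jk] : (p %| k)%N.
  rewrite -(dvdn_pmul2r (prime_gt0 p_pr)) mulnn -ord_u order_dvdn.
  by rewrite expgM -xyE xyp.
have Kxy : [~ x, y] * (u ^+ p ^+ j)^-1 \in K.
  have nKup : u ^+ p ^+ j \in 'N(K) by rewrite !groupX.
  rewrite coset_idr ?groupM ?groupV ?groupR // morphM ?groupV ?groupR //.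
  by rewrite morphV //= xyE uE -expgM mulnC -jk morphX //= mulgV.
rewrite -(mulgKV (u ^+ p ^+ j) [~ x, y]); apply: groupM.
  exact: subsetP KZ _ Kxy.
rewrite groupX //; apply/setIP; split; first by rewrite groupX ?(subsetP sDG).
by apply/centP=> g Gg; apply/commgP/eqP/cenU.
Qed.

(** * Codegrees in order p^5 *)

Lemma codegree_p5 (p : nat) (gT : finGroupType) (G : {group gT}) (i : Iirr G)
    (n := logn p #|G : cfker ('chi_i)%R|) :
    prime p -> #|G| = (p ^ 5)%N -> (2 < nil_class G)%N ->
    cd G = [fset 1; p%:R]%fset%R ->
  (n <= 2)%N /\ codegree ('chi_i)%R = (p%:R ^+ n)%R \/
  [/\ ('chi_i)%R 1 = p%:R%R, (2 < n <= 5)%N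
    & codegree ('chi_i)%R = (p%:R ^+ n.-1)%R].
Proof.
move=> p_pr oG clG cdG.
have pG : p.-group G by rewrite /pgroup oG pnatX pnat_id.
have nabG : ~~ abelian G by rewrite -nil_class1 -ltnNge ltnW.
have ix : #|G : cfker ('chi_i)%R| = (p ^ n)%N.
  by rewrite -p_part part_pnat_id // (pnat_dvd (dvdn_indexg _ _) pG).
have p_neq0 : (p%:R != 0 :> algC)%R by rewrite pnatr_eq0 -lt0n prime_gt0.
have [lin_i | nlin_i] := boolP (('chi_i)%R \is a linear_char).
  left; rewrite /codegree lin_char1 // ix divr1 natrX; split=> //.
  have := lin_char_logn_index p _ _ _ pG nabG lin_i.
  (* Class at least 3 gives |G'| >= p^2, so |G : G'| <= p^3 and the strict bound yields n <= 2. *)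
  have := nil_class_lcn_logn p _ G 2 pG isT; rewrite lcn2.
  have := logn_indexg p _ _ _ (der_sub 1 G); rewrite oG pfactorK //= -/n.
  by move: (logn _ _) (logn _ _) => a b; lia.
right.
have chi1 : ('chi_i)%R 1 = p%:R%R.
  have : ('chi_i)%R 1 \in cd G by apply: in_imfset.
  rewrite cdG !inE => /orP[/eqP chi1 | /eqP //].
  by case/negP: nlin_i; rewrite qualifE /= irr_char chi1 eqxx.
have n_gt2 : (2 < n)%N.
  apply: lcn_logn_indexg => //; first exact: cfker_normal.
  by rewrite lcn2 -lin_irr_der1.
have n_le5 : (n <= 5)%N.
  by rewrite -(@pfactorK p 5) // -oG dvdn_leq_log ?dvdn_indexg.
split=> //; first by rewrite n_gt2.
rewrite /codegree ix chi1 natrX; case: (n) n_gt2 => // m _.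
by rewrite exprSr mulfK.
Qed.

(** The size condition on N says |G : N| <= p^(n+1). A character that is trivial on N but not on
    'L_n therefore has kernel of index exactly p^(n+1), and its degree is p. *)
Lemma cod_lcn_sep (p : nat) (gT : finGroupType) (G N : {group gT}) (n : nat) :
    prime p -> #|G| = (p ^ 5)%N -> (2 < nil_class G)%N ->
    cd G = [fset 1; p%:R]%fset%R ->
    N <| G -> (1 < n)%N -> ~~ ('L_n(G) \subset N) ->
    (3 < n + logn p #|N|)%N ->
  (p%:R ^+ n)%R \in cod G.
Proof.
move=> p_pr oG clG cdG nsNG n_gt1 nLN leN.
have pG : p.-group G by rewrite /pgroup oG pnatX pnat_id.
have [i sNi nLi] := exists_irr_sep _ _ _ _ nsNG nLN.
have lt_n := lcn_logn_indexg p _ _ _ _ pG (cfker_normal ('chi_i)%R) n_gt1 nLi.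
have le_n : (logn p #|G : cfker ('chi_i)%R| <= n.+1)%N.
  apply: leq_trans (dvdn_leq_log p (indexg_gt0 G N) (indexgS G sNi)) _.
  rewrite -(leq_add2l (logn p #|N|)) logn_indexg ?normal_sub // oG pfactorK //.
  by rewrite addnS addnC.
have en : logn p #|G : cfker ('chi_i)%R| = n.+1.
  by apply/eqP; rewrite eqn_leq le_n lt_n.
have := codegree_p5 p _ _ i p_pr oG clG cdG; rewrite en.
case=> [[lt_n2 _] | [_ _ /= <-]]; last exact: in_imfset.
by rewrite ltnS leqNgt n_gt1 in lt_n2.
Qed.

Lemma cod_1 (gT : finGroupType) (G : {group gT}) : 1%R \in cod G.
Proof.
apply/imfsetP; exists 0%R => //.
by rewrite /codegree irr0 cfker_cfun1 indexgg cfun11 divr1.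
Qed.

(** A nontrivial character of G / M, with M maximal and hence normal of index p, is linear and has
    kernel of index p. *)
Lemma cod_prime (p : nat) (gT : finGroupType) (G : {group gT}) :
  p.-group G -> G :!=: 1 -> p%:R%R \in cod G.
Proof.
move=> pG ntG; have [p_pr _ _] := pgroup_pdiv pG ntG.
have [G1 | [M maxM _]] := maximal_exists (sub1G G).
  by rewrite -G1 eqxx in ntG.
have nsMG := p_maximal_normal pG maxM; have oGM := p_maximal_index pG maxM.
have nGM : ~~ (G \subset M) by case/maxgroupp/andP: maxM.
have [i sMi nGi] := exists_irr_sep _ _ _ _ nsMG nGM.
have lin_i : ('chi_i)%R \is a linear_char.
  rewrite lin_irr_der1 (subset_trans _ sMi) // der1_min ?normal_norm //.
  by rewrite cyclic_abelian // prime_cyclic // card_quotient ?normal_norm //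
    oGM.
have ix : #|G : cfker ('chi_i)%R| = p.
  have : #|G : cfker ('chi_i)%R| %| p by rewrite -oGM indexgS.
  case/primeP: p_pr => _ dvp /dvp/orP[|/eqP//].
  by rewrite indexg_eq1 (negPf nGi).
apply/imfsetP; exists i => //.
by rewrite /codegree ix lin_char1 // divr1.
Qed.

Theorem lemma3p5 (p : nat) (gT : finGroupType) (G : {group gT})
    (p_pr : prime p) (p_gt3 : (3 < p)%N)
    (nabG : ~~ abelian G) (oG : #|G| = (p ^ 5)%N)
    (clG : (3 <= nil_class G)%N)
    (cdG : cd G = [fset 1; p%:R]%fset%R) :
  (~~ cyclic 'Z(G) ->
     cod G = [fset 1; p%:R; p%:R ^+ 2; p%:R ^+ 3]%fset%R) /\
  (cyclic 'Z(G) ->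
     (nil_class G = 3 ->
        [/\ #|` cod G| = 4,
            (1%R \in cod G) /\ (p%:R%R \in cod G) /\ ((p%:R ^+ 4)%R \in cod G)
          & ~~ p.-abelem (G / G^`(1)) ->
            cod G = [fset 1; p%:R; p%:R ^+ 2; p%:R ^+ 4]%fset%R]) /\
     (nil_class G = 4 ->
        cod G = [fset 1; p%:R; p%:R ^+ 2; p%:R ^+ 3; p%:R ^+ 4]%fset%R)).
Proof.
have pG : p.-group G by rewrite /pgroup oG pnatX pnat_id.
have ntG : G :!=: 1 by apply: contra nabG => /eqP->; apply: abelian1.
have cod1 := cod_1 _ G; have codp := cod_prime p _ G pG ntG.
have codP i := codegree_p5 p _ _ i p_pr oG clG cdG.
have sep N n := cod_lcn_sep p _ _ N n p_pr oG clG cdG.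
have logL n := nil_class_lcn_logn p _ G n pG.
have logK (i : Iirr G) : (logn p #|cfker ('chi_i)%R| +
                          logn p #|G : cfker ('chi_i)%R| = 5)%N.
  by rewrite logn_indexg ?cfker_sub // oG pfactorK.
have nL n : (0 < n)%N -> (n <= nil_class G)%N ->
    ~~ ('L_n(G) \subset 'L_n.+1(G)).
  move=> n_gt0 len; have := lcn_proper _ G n (pgroup_nil pG) n_gt0.
  rewrite properE => /(_ _)/andP[] //.
  by apply/eqP => Ln1; have := logL n n_gt0; rewrite Ln1 cards1 logn1; lia.
split=> [ncycZ | cycZ].
  have codp2 : (p%:R ^+ 2)%R \in cod G.
    apply: (sep 'Z(G)%G) => //; first exact: center_normal.
      by rewrite lcn2 -nil_class2 -ltnNge.
    rewrite ltnNge; apply: contra ncycZ => leZ1.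
    apply: cyclic_logn_le1 (pgroupS (center_sub G) pG) _; lia.
  have n_neq5 (i : Iirr G) : logn p #|G : cfker ('chi_i)%R| != 5.
    apply: contra ncycZ => /eqP n5; apply: (@irr_faithful_center _ _ i).
    have := logK i; rewrite n5 => k0.
    have pK := pgroupS (cfker_sub ('chi_i)%R) pG.
    rewrite /cfaithful subG1 trivg_card1 (card_pgroup pK).
    by have -> : logn p #|cfker ('chi_i)%R| = 0%N by lia.
  (* A character nontrivial on 'L_3 has n >= 4, and n = 5 was just excluded. *)
  have codp3 : (p%:R ^+ 3)%R \in cod G.
    have nL3 : ~~ ('L_3(G) \subset [1 gT]).
      have := nL 3 isT clG; apply: contra => /subset_trans; apply.
      exact: sub1G.
    have [i _ nLi] := exists_irr_sep _ _ _ _ (normal1 G) nL3.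
    have := lcn_logn_indexg p _ _ _ 3 pG (cfker_normal ('chi_i)%R) isT nLi.
    have := n_neq5 i; case: (codP i) => [[le2 _] | [_]].
      by rewrite ltnNge (leq_trans le2).
    case En: (logn _ _) => [|[|[|[|[|[|//]]]]]] //= _ <- _ _.
    exact: in_imfset.
  apply/fsetP=> c; rewrite !inE; apply/idP/idP; last first.
    by move=> /orP[/orP[/orP[]|]|] /eqP->.
  case/imfsetP=> /= i _ ->.
  case: (codP i) => [[] | [_]].
    by case: (logn _ _) => [|[|[|//]]] _ ->; rewrite ?expr1 ?expr0 eqxx ?orbT.
  have := n_neq5 i.
  by case: (logn _ _) => [|[|[|[|[|[|//]]]]]] //= _ _ ->; rewrite eqxx ?orbT.
have codp4 : (p%:R ^+ 4)%R \in cod G.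
  have [i /trivgP fi] := pgroup_cyclic_faithful pG cycZ.
  have := codP i; rewrite fi indexg1 oG pfactorK //.
  by case=> [[]// | [_ _ <-]]; apply: in_imfset.
split=> clG34.
  (* The cardinality is read off this equality, the four powers of p being distinct. *)
  suffices codE : cod G = [fset 1; p%:R; p%:R ^+ 2; p%:R ^+ 4]%fset%R.
    split=> //; rewrite codE.
    have eqX a b : ((p%:R : algC) ^+ a == p%:R ^+ b)%R = (a == b).
      by rewrite -!natrX eqC_nat eqn_exp2l ?prime_gt1.
    have eqX1 a : ((p%:R : algC) ^+ a == 1)%R = (a == 0)%N := eqX a 0%N.
    have eqXp a : ((p%:R : algC) ^+ a == p%:R)%R = (a == 1)%N := eqX a 1%N.
    do 3![rewrite fsetUC cardfsU1 !inE]; rewrite cardfs1 !eqX1 !eqXp !eqX.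
    by rewrite (eqX 1%N 0%N).
  have nK1 (i : Iirr G) :
      ('chi_i)%R 1 = p%:R%R -> logn p #|cfker ('chi_i)%R| != 1%N.
    move=> chi1; have pK := pgroupS (cfker_sub ('chi_i)%R) pG.
    apply: contra (class3_card_cfker_neq p _ _ i p_pr oG clG34 cycZ chi1).
    by rewrite [X in _ -> X == _](card_pgroup pK) => /eqP->; rewrite expn1.
  (* Here |'L_3| = p is too small for [sep]. The kernel contains 'L_3, and its order is not p, so it
     is at least p^2; this forces n = 3. *)
  have codp2 : (p%:R ^+ 2)%R \in cod G.
    have nL2 : ~~ ('L_2(G) \subset 'L_3(G)) by apply: nL; rewrite ?clG34.
    have [i sLi nLi] := exists_irr_sep _ _ _ _ (lcn_normal 3 G) nL2.
    have := lcn_logn_indexg p _ _ _ 2 pG (cfker_normal ('chi_i)%R) isT nLi.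
    case: (codP i) => [[le2 _] | [chi1]]; first by rewrite ltnNge le2.
    have := nK1 i chi1; have := logK i.
    have := dvdn_leq_log p (cardG_gt0 _) (cardSg sLi).
    rewrite /= (class3_card_lcn3 p) // (logn_prime p p_pr) eqxx.
    case: (logn p #|cfker _|) => [|[|k]] // _; rewrite 2!addSn.
    case: (logn _ _) => [|[|[|[|n]]]] //=; last by rewrite !addnS.
    by move=> _ _ _ <- _; apply: in_imfset.
  apply/fsetP=> c; rewrite !inE; apply/idP/idP; last first.
    by move=> /orP[/orP[/orP[]|]|] /eqP->.
  case/imfsetP=> /= i _ ->.
  case: (codP i) => [[] | [chi1]].
    by case: (logn _ _) => [|[|[|//]]] _ ->; rewrite ?expr1 ?expr0 eqxx ?orbT.
  case En: (logn _ _) => [|[|[|[|[|[|//]]]]]] //= _ ->; rewrite ?eqxx ?orbT //.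
  have /negP nk := nK1 i chi1; have /eqP := logK i.
  by rewrite En -[5]/(1 + 4)%N eqn_add2r => /nk.
(* In class 4, |'L_3| >= p^2 and |'L_4| >= p, exactly the sizes that [sep] requires for n = 2 and n
   = 3. *)
have codp2 : (p%:R ^+ 2)%R \in cod G.
  apply: (sep 'L_3(G)%G) => //; first exact: lcn_normal; last first.
    by have := logL 3 isT; rewrite clG34.
  by apply: nL => //; lia.
have codp3 : (p%:R ^+ 3)%R \in cod G.
  apply: (sep 'L_4(G)%G) => //; first exact: lcn_normal; last first.
    by have := logL 4 isT; rewrite clG34.
  by apply: nL => //; lia.
apply/fsetP=> c; rewrite !inE; apply/idP/idP; last first.
  by move=> /orP[/orP[/orP[/orP[]|]|]|] /eqP->.
case/imfsetP=> /= i _ ->.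
case: (codP i) => [[] | [_]].
  by case: (logn _ _) => [|[|[|//]]] _ ->; rewrite ?expr1 ?expr0 eqxx ?orbT.
by case: (logn _ _) => [|[|[|[|[|[|//]]]]]] //= _ ->; rewrite eqxx ?orbT.
Qed.
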